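(* There is a constant $c$ such that for every positive integer $n$, $$c_{2,S_3}(n)\leq c\cdot 18^{3n/10}.$$ In particular, $b_{2,S_3}\leq 18^{3/10}\approx 2.38$.
   Context: For a positive integer $t$, $S_t$ denotes the star with $t$ edges (and $t+1$ vertices). For a positive integer $r$ and graphs $G,H$ (simple graphs), $c_{r,H}(G)$ is the number of $r$-edge-colorings of $G$ (functions $c:E(G)\to\{1,\dots,r\}$) with no monochromatic copy of $H$ as a subgraph. $c_{r,H}(n)$ is the maximum of $c_{r,H}(G)$ over all graphs $G$ on $n$ vertices. For connected $H$, the function $n\mapsto c_{r,H}(n)$ is supermultiplicative, so the limit $b_{r,H}=\lim_{n\to\infty} c_{r,H}(n)^{1/n}\in\mathbb{R}\cup\{\infty\}$ exists. *)

(* Defs.v *)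
(* Mathematical Components world, with MathComp-Analysis for real powers and
   limits. *)
From HB Require Import structures.
From mathcomp Require Import all_boot all_order all_algebra.
From mathcomp Require Import all_classical all_reals all_analysis.
Set Implicit Arguments.
Unset Strict Implicit.
Unset Printing Implicit Defensive.
Import Order.TTheory GRing.Theory Num.Theory.
Import numFieldNormedType.Exports.
Local Open Scope ring_scope.

(* Simple graphs with vertex set the whole of T; an edge is the two-element
   set of its endpoints. *)
Record sgraph (T : finType) := SGraph {
  edges :> {set {set T}};
  _ : [forall e in edges, #|e| == 2%N]
}.
HB.instance Definition _ (T : finType) := [isSub for @edges T].
HB.instance Definition _ (T : finType) := [Countable of sgraph T by <:].
HB.instance Definition _ (T : finType) := [Finite of sgraph T by <:].

Definition edge (T : finType) (G : sgraph T) := {e : {set T} | e \in edges G}.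

Definition coloring (r : nat) (T : finType) (G : sgraph T) :=
  {ffun edge G -> 'I_r}.

(* A copy of H in G, not necessarily induced, is given by an injective map f
   on vertices sending every edge of H to an edge of G. *)
Definition has_mono_copy (S : finType) (H : sgraph S) (r : nat) (T : finType)
    (G : sgraph T) (c : coloring r G) : bool :=
  [exists f : {ffun S -> T}, exists k : 'I_r,
     injectiveb f &&
     [forall e in edges H,
        [exists e' : edge G, (val e' == f @: e) && (c e' == k)]]].

Definition num_colorings (r : nat) (S : finType) (H : sgraph S)
    (T : finType) (G : sgraph T) : nat :=
  #|[set c : coloring r G | ~~ has_mono_copy H c]|.

Definition max_num_colorings (r : nat) (S : finType) (H : sgraph S)
    (n : nat) : nat :=
  (\max_(G : sgraph 'I_n) num_colorings r H G)%N.

Definition star_edges (t : nat) : {set {set 'I_t.+1}} :=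
  [set [set ord0; lift ord0 i] | i : 'I_t].

Lemma star_edgesP (t : nat) : [forall e in star_edges t, #|e| == 2%N].
Proof. by apply/forall_inP => _ /imsetP[i _ ->]; rewrite cards2 neq_lift. Qed.

Definition star (t : nat) : sgraph 'I_t.+1 := SGraph (star_edgesP t).

Definition root_max_num_colorings (R : realType) (r : nat) (S : finType)
    (H : sgraph S) (n : nat) : \bar R :=
  (((max_num_colorings r H n)%:R : R) `^ (n%:R^-1))%:E.

(* The limit is taken in the extended reals since it may be infinite. As lim
   is a total operator, this value is meaningful only when the sequence
   converges. *)
Definition coloring_growth (R : realType) (r : nat) (S : finType)
    (H : sgraph S) : \bar R :=
  limn (root_max_num_colorings R r H).

(* Main.v *)
(* A coloring has no monochromatic S_3 iff every color occurs at most twice at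
   each vertex.  Hence all degrees are at most 4, and once the color of one edge
   at a vertex of degree d is fixed, the other edges at that vertex can be
   colored in at most 1, 2, 3, 3 ways for d = 1, 2, 3, 4.  Let A(d) be twice this
   number: the star at v carries at most A(deg v) colorings, and the double star
   of an edge uv (all edges meeting it) at most A(deg u) A(deg v) / 2.

   These local counts are combined by Shearer's inequality, applied to stars and
   double stars with weights chosen so that every edge is covered with total
   weight 30.  Give v the number z(v) = 3, 1 or 0 according to whether its degree
   is 3, 4 or neither.  The double star of uv has weight z(u) + z(v), and the star
   at v has weight 15 + z(v) - s(v), where s(v) is the total weight of the double
   stars centered at the edges at v.  The resulting bound on the 30th power of the
   number of colorings is a product over the vertices of
   A(d)^(15 + z) / 2^(d z) <= 18^9, with equality for d = 3.

   The limit exists by Fekete's lemma, since colorings of two graphs combine to a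
   coloring of their disjoint union. *)
Require Import Defs.
From HB Require Import structures.
From mathcomp Require Import all_boot all_order all_algebra.
From mathcomp Require Import all_classical all_reals all_analysis.
From mathcomp Require Import ring lra zify.
Set Implicit Arguments.
Unset Strict Implicit.
Unset Printing Implicit Defensive.
Import Order.TTheory GRing.Theory Num.Theory.
Import numFieldNormedType.Exports.
Local Open Scope ring_scope.

(** * Shearer's inequality *)

(* A form of Hoelder's inequality, proved by applying AM-GM to the normalized
   terms [u i j / \sum_i u i j]. *)
Lemma sum_le_prod_sum (R : realType) (I J : finType) (A : {set J}) (k : nat)
    (f : I -> R) (u : I -> J -> R) (C : R) :
  (0 < k <= #|A|)%N -> 0 <= C -> (forall i, 0 <= f i) ->
  (forall i j, 0 <= u i j) ->
  (forall i, f i ^+ k <= C * \prod_(j in A) u i j) ->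
  (\sum_i f i) ^+ k <= C * \prod_(j in A) \sum_i u i j.
Proof.
move=> /andP[k_gt0 kA] C_ge0 f_ge0 u_ge0 fu.
pose U j := \sum_i u i j.
have U_ge0 j : 0 <= U j by apply: sumr_ge0.
(* A zero [U j0] rules out normalizing, but then every [f i] is zero. *)
have [/existsP[j0 /andP[j0A /eqP Uj0]]|/existsPn U_neq0] :=
    boolP [exists j, (j \in A) && (U j == 0)].
  have u0 i : u i j0 = 0.
    by have/psumr_eq0P := Uj0; apply => // i' _; apply: u_ge0.
  rewrite big1 ?expr0n ?(gtn_eqF k_gt0); last first.
    move=> i _; have := fu i; rewrite (bigD1 j0) //= u0 mul0r mulr0 => fi0.
    have /eqP : f i ^+ k = 0 by apply/eqP; rewrite eq_le fi0 exprn_ge0.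
    by rewrite expf_eq0 k_gt0 => /eqP.
  by rewrite mulr_ge0 // prodr_ge0 // => j _; apply: U_ge0.
have U_gt0 j : j \in A -> 0 < U j.
  by move=> jA; rewrite lt_neqAle eq_sym U_ge0 andbT; have := U_neq0 j; rewrite jA.
pose m := #|A|; have m_gt0 : (0 < m)%N by exact: leq_trans kA.
(* [D] is the [k]-th root of the right-hand side; the goal follows from [f i <= D * M i], since the
   [M i] sum to 1. *)
pose D := (C * \prod_(j in A) U j) `^ (k%:R^-1).
have DE : D ^+ k = C * \prod_(j in A) U j.
  rewrite -powR_mulrn ?powR_ge0// /D -powRrM mulVf ?powRr1 ?pnatr_eq0 -?lt0n//.
  by rewrite mulr_ge0 ?prodr_ge0.
pose M i := (\sum_(j in A) u i j / U j) / m%:R.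
have p_ge0 i j : 0 <= u i j / U j by rewrite divr_ge0.
have M_ge0 i : 0 <= M i by rewrite divr_ge0 ?sumr_ge0.
have sumM : \sum_i M i = 1.
  rewrite -mulr_suml exchange_big /= (eq_bigr (fun=> 1)).
    by rewrite sumr_const mulfV // pnatr_eq0 -lt0n.
  by move=> j jA; rewrite -mulr_suml mulfV // gt_eqF ?U_gt0.
have M_le1 i : M i <= 1.
  by rewrite -sumM (bigD1 i) //= lerDl sumr_ge0.
have fDM i : f i <= D * M i.
  have DM_ge0 : 0 <= D * M i by exact: mulr_ge0 (powR_ge0 _ _) (M_ge0 i).
  rewrite -(@ler_pXn2r _ k) ?nnegrE //.
  apply: le_trans (fu i) _; rewrite exprMn DE -mulrA ler_wpM2l //.
  have -> : \prod_(j in A) u i j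
      = \prod_(j in A) U j * \prod_(j in A) (u i j / U j).
    rewrite -big_split /=; apply: eq_bigr => j jA.
    by rewrite mulrC divfK // gt_eqF ?U_gt0.
  rewrite ler_wpM2l ?prodr_ge0 //.
  have /(_ _)/leif_le := @leif_AGM R J A (fun j => u i j / U j).
  move=> /(_ (fun j _ => p_ge0 i j)) /le_trans; apply.
  (* AM-GM yields the exponent [#|A|]; as [M i] lies between 0 and 1, it may be lowered to [k]. This
     is why covering more than [k] times is harmless. *)
  exact: (ler_wiXn2l (M_ge0 i) (M_le1 i) kA).
rewrite -[leRHS]DE ler_pXn2r ?nnegrE ?sumr_ge0 ?powR_ge0//.
by apply: le_trans (ler_sum _ (fun i _ => fDM i)) _; rewrite -mulr_sumr sumM mulr1.
Qed.

(** Restriction to [S], padded with [None] so that restrictions to different sets share one finite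
    type. *)
Definition ffun_proj (E X : finType) (S : {set E}) (c : {ffun E -> X}) :
    {ffun E -> option X} :=
  [ffun e => if e \in S then Some (c e) else None].

Lemma shearer_unweighted (R : realType) (E X J : finType) (k : nat)
    (S : J -> {set E}) (F : {set {ffun E -> X}}) :
  (0 < k)%N -> (forall e, k <= #|[set j | e \in S j]|)%N ->
  #|F|%:R ^+ k <= \prod_j (#|ffun_proj (S j) @: F|%:R : R).
Proof.
move=> k_gt0 cover.
(* Induction on a set Z of coordinates outside of which F is constant: split F
   by its value at some e in Z and recombine with [sum_le_prod_sum] over the j
   with e in S j; the other factors only grow. *)
suff gen n (Z : {set E}) : #|Z| = n ->
    forall F : {set {ffun E -> X}},
    {in F &, forall c c' : {ffun E -> X}, forall e, e \notin Z -> c e = c' e} ->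
    #|F|%:R ^+ k <= \prod_j (#|ffun_proj (S j) @: F|%:R : R).
  by apply: (gen _ [set: E] erefl) => c c' _ _ e; rewrite inE.
elim: n Z => [|n IHn] Z cZ {}F agree.
  have [->|[c cF]] := set_0Vmem F.
    by rewrite cards0 expr0n (gtn_eqF k_gt0) prodr_ge0.
  have -> : F = [set c].
    apply/setP=> c'; rewrite inE; apply/idP/eqP => [c'F|->//].
    by apply/ffunP=> e; apply: agree => //; rewrite (cards0_eq cZ) inE.
  rewrite cards1 expr1n big1 // => j _.
  by rewrite imset_set1 cards1.
have /card_gt0P[e eZ] : (0 < #|Z|)%N by rewrite cZ.
pose Fa a := [set c in F | c e == a].
have cF : #|F|%:R = \sum_a #|Fa a|%:R :> R.
  rewrite -natr_sum; congr _%:R.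
  rewrite -sum1_card (partition_big (fun c : {ffun E -> X} => c e) predT) //=.
  by apply: eq_bigr => a _; rewrite -sum1_card; apply: eq_bigl => c; rewrite !inE.
have IH a : #|Fa a|%:R ^+ k <= \prod_j (#|ffun_proj (S j) @: Fa a|%:R : R).
  apply: (IHn (Z :\ e)) => [|c c'].
    by move: cZ; rewrite (cardsD1 e) eZ => -[].
  rewrite !inE => /andP[cF1 /eqP ca] /andP[c'F /eqP c'a] e'.
  rewrite !inE negb_and negbK => /orP[/eqP->|]; first by rewrite ca c'a.
  exact: agree.
pose A := [set j | e \in S j].
rewrite cF (bigID (fun j => j \in A)) /= mulrC.
apply: (@le_trans _ _ ((\prod_(j | j \notin A) #|ffun_proj (S j) @: F|%:R)
    * \prod_(j in A) \sum_a (#|ffun_proj (S j) @: Fa a|%:R : R))).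
  apply: sum_le_prod_sum; rewrite ?k_gt0 ?cover ?prodr_ge0 // => a.
  apply: le_trans (IH a) _; rewrite (bigID (fun j => j \in A)) /= mulrC.
  rewrite ler_wpM2r ?prodr_ge0 // ler_prod // => j _.
  rewrite ler0n ler_nat subset_leq_card //=.
  by apply/imsetS/fintype.subsetP => c; rewrite inE => /andP[].
rewrite ler_wpM2l ?prodr_ge0 // ler_prod // => j; rewrite inE => eSj.
rewrite sumr_ge0 //= -natr_sum ler_nat.
pose P := ffun_proj (S j) @: F.
(* Since [e] is in [S j], a projection remembers the value at [e], so it is counted for at most one
   [a]. *)
have sub a : (#|ffun_proj (S j) @: Fa a| <= \sum_(p in P) (p e == Some a))%N.
  rewrite -big_mkcondr /= sum1dep_card subset_leq_card //.
  apply/fintype.subsetP => _ /imsetP[c + ->]; rewrite !inE => /andP[cF' /eqP <-].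
  by rewrite imset_f //= ffunE eSj.
apply: leq_trans (leq_sum _ (fun a _ => sub a)) _.
rewrite exchange_big /= -sum1_card leq_sum // => p _.
case: (p e) => [x|]; last by rewrite big1.
rewrite (bigD1 x) //= eqxx big1 // => a /negPf ax.
by have -> : (Some x == Some a) = (x == a) by []; rewrite eq_sym ax.
Qed.

(** Each [S j] is repeated [w j] times, the copies being indexed by a dependent sum, and the
    unweighted form applies. *)
Lemma shearer (R : realType) (E X J : finType) (k : nat) (w : J -> nat)
    (S : J -> {set E}) (F : {set {ffun E -> X}}) :
  (0 < k)%N -> (forall e, k <= \sum_(j | e \in S j) w j)%N ->
  #|F|%:R ^+ k <= \prod_j (#|ffun_proj (S j) @: F|%:R ^+ w j : R).
Proof.
move=> k_gt0 cover.
have := @shearer_unweighted R E X {j & 'I_(w j)} k (S \o tag) F k_gt0.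
have -> : \prod_(j : {j & 'I_(w j)}) (#|ffun_proj ((S \o tag) j) @: F|%:R : R)
    = \prod_j #|ffun_proj (S j) @: F|%:R ^+ w j.
  rewrite -(@sig_big_dep _ _ _ _ (fun j => 'I_(w j)) xpredT (fun _ => xpredT)
    (fun j _ => #|ffun_proj (S j) @: F|%:R : R)) /=.
  by apply: eq_bigr => j _; rewrite prodr_const card_ord.
apply=> e; apply: leq_trans (cover e) _.
have -> : #|[set p : {j & 'I_(w j)} | e \in (S \o tag) p]|
    = (\sum_(j | e \in S j) \sum_(i < w j) 1)%N.
  by rewrite -sum1dep_card sig_big_dep; apply: eq_bigl => p; rewrite andbT.
by apply: leq_sum => j _; rewrite sum1_card card_ord.
Qed.

(** * Fekete's lemma and convergence of roots *)

(** The limit is the supremum of [a n / n], finite by the linear bound. If [m] nearly attains it,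
    then [a n >= (n %/ m) * a m], the remainder being dropped by nonnegativity, and rounding costs
    at most [a m / n]. *)
Lemma fekete (R : realType) (a : nat -> R) (M : R) :
  (forall m n, a m + a n <= a (m + n)%N) -> (forall n, 0 <= a n) ->
  (forall n, a n <= M * n%:R) ->
  cvgn (fun n => a n / n%:R).
Proof.
move=> aD a_ge0 aM.
pose E : set R := [set x | exists2 n, (0 < n)%N & x = a n / n%:R]%classic.
have Eub : has_ubound E.
  by exists M => _ [n n0 ->]; rewrite ler_pdivrMr ?ltr0n.
have Esup : has_sup E by split => //; exists (a 1%N / 1%:R); exists 1%N.
apply/cvg_ex; exists (sup E); apply/cvgrPdist_le => eps eps_gt0.
have eps2 : 0 < eps / 2 by rewrite divr_gt0.
have [_ [m m_gt0 ->] Lm] := sup_adherent eps2 Esup.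
near=> n.
have n_gt0 : (0 < n)%N by near: n; exact: nbhs_infty_gt.
have nr_gt0 : 0 < n%:R :> R by rewrite ltr0n.
have mr_gt0 : 0 < m%:R :> R by rewrite ltr0n.
have amn : a m / n%:R <= eps / 2.
  rewrite ler_pdivrMr // mulrC -ler_pdivrMr //.
  by near: n; exact: nbhs_infty_ger.
have anL : a n / n%:R <= sup E by apply: ub_le_sup => //; exists n.
have aMm q : q%:R * a m <= a (q * m)%N.
  elim: q => [|q IHq]; first by rewrite mul0r.
  rewrite mulSn -natr1 mulrDl mul1r addrC.
  by apply: le_trans (aD _ _); rewrite lerD2l.
have an : (n %/ m)%:R * a m <= a n.
  apply: le_trans (aMm _) _; rewrite [in leRHS](divn_eq n m).
  by apply: le_trans (aD _ _); rewrite lerDl.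
have nm : n%:R / m%:R - 1 <= (n %/ m)%:R :> R.
  rewrite lerBlDr natr1 ler_pdivrMr // -natrM ler_nat.
  by rewrite ltnW // ltn_ceil.
have lb : a m / m%:R - a m / n%:R <= a n / n%:R.
  rewrite ler_pdivlMr // mulrBl divfK ?gt_eqF //.
  apply: le_trans an; rewrite (_ : _ - _ = (n%:R / m%:R - 1) * a m).
    by rewrite ler_wpM2r.
  by rewrite mulrBl mul1r mulrAC [in RHS]mulrAC [a m * _]mulrC.
rewrite ger0_norm ?subr_ge0 // lerBlDr.
move: Lm amn lb => /ltW; lra.
Unshelve. all: by end_near. Qed.

(** Logarithms turn this into [fekete], and [expR] is continuous. The logarithms are nonnegative
    because [u n] is a positive integer. *)
Lemma supermultiplicative_root_cvg (R : realType) (u : nat -> nat) (B : R) :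
  0 < B -> (forall n, 0 < u n)%N ->
  (forall m n, u m * u n <= u (m + n))%N ->
  (forall n, (u n)%:R <= B ^+ n) ->
  cvgn (fun n => (u n)%:R `^ (n%:R^-1) : R).
Proof.
move=> B_gt0 u_gt0 uM uB.
have ur_gt0 n : 0 < (u n)%:R :> R by rewrite ltr0n.
have : cvgn (fun n => ln (u n)%:R / n%:R : R).
  apply: (@fekete R _ (ln B)) => [m n|n|n].
  - by rewrite -lnM ?posrE // ler_ln ?posrE ?mulr_gt0 // -natrM ler_nat.
  - by rewrite ln_ge0 // ler1n.
  - by rewrite mulr_natr -lnXn // ler_ln ?posrE ?exprn_gt0.
move=> /cvg_ex[/= l ul]; apply/cvg_ex; exists (expR l).
have := cvg_comp _ _ ul (@continuous_expR R l).
apply: cvg_trans; apply: near_eq_cvg; apply: nearW => n /=.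
by rewrite /powR gt_eqF // mulrC.
Qed.

(** * Edges at a vertex and monochromatic stars *)

Definition edges_at (T : finType) (G : sgraph T) (v : T) : {set edge G} :=
  [set e : edge G | v \in val e].

Lemma card_edge (T : finType) (G : sgraph T) (e : edge G) : #|val e| = 2%N.
Proof. by case: G e => E E2 [e eE] /=; apply/eqP/(forall_inP E2). Qed.

Lemma edge_at_pair (T : finType) (G : sgraph T) (v : T) (e : edge G) :
  e \in edges_at G v -> exists2 w, w != v & val e = [set v; w].
Proof.
rewrite inE => ve; have /eqP/cards2P[x [y [xy exy]]] := card_edge e.
move: ve; rewrite exy !inE => /orP[] /eqP->.
  by exists y; rewrite // eq_sym.
by exists x; rewrite // finset.setUC.
Qed.

Lemma edge_pair (T : finType) (G : sgraph T) (e : edge G) :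
  exists u w, [/\ u != w & val e = [set u; w]].
Proof.
by have /eqP/cards2P[u [w [uw ew]]] := card_edge e; exists u, w.
Qed.

(** The vertex [v] is the image of the center. An edge at [v] amounts to its other endpoint, so
    distinct leaves give distinct edges and conversely. *)
Lemma has_mono_starE (t r : nat) (T : finType) (G : sgraph T)
    (c : coloring r G) :
  has_mono_copy (star t) c =
  [exists v, exists k, (t <= #|[set e in edges_at G v | c e == k]|)%N].
Proof.
apply/existsP/existsP => [[f /existsP[k /andP[/injectiveP f_inj]]]|].
  move=> /forall_inP copy; exists (f ord0); apply/existsP; exists k.
  have /fin_all_exists[g gP] (i : 'I_t) : exists e : edge G,
      val e = [set f ord0; f (lift ord0 i)] /\ c e == k.
    have /copy/existsP[e /andP[/eqP ei ck]] :
      [set ord0; lift ord0 i] \in edges (star t) by apply: imset_f.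
    by exists e; rewrite ei imsetU1 imset_set1.
  have g_inj : injective g.
    move=> i j gij; have : f (lift ord0 i) \in val (g j).
      by rewrite -gij (gP i).1 !inE eqxx orbT.
    rewrite (gP j).1 !inE => /orP[] /eqP/f_inj; last exact: lift_inj.
    by move/eqP; rewrite eq_sym (negPf (neq_lift _ _)).
  rewrite -[leqLHS]card_ord -(card_imset _ g_inj) subset_leq_card //.
  apply/fintype.subsetP => _ /imsetP[i _ ->].
  by rewrite !inE (gP i).2 (gP i).1 !inE eqxx.
move=> [v /existsP[k tB]]; set B := [set e in _ | _] in tB.
pose g (i : 'I_t) : edge G := enum_val (widen_ord tB i).
have gB i : g i \in B by exact: enum_valP.
have g_inj : injective g by move=> i j /enum_val_inj/(congr1 val) /= /val_inj.
have /fin_all_exists[w wP] (i : 'I_t) : exists w, w != v /\ val (g i) = [set v; w].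
  have := gB i; rewrite inE => /andP[/edge_at_pair[w wv gw] _].
  by exists w.
pose f : {ffun 'I_t.+1 -> T} :=
  [ffun i => if unlift ord0 i is Some j then w j else v].
have f0 : f ord0 = v by rewrite ffunE unlift_none.
have fS j : f (lift ord0 j) = w j by rewrite ffunE liftK.
exists f; apply/existsP; exists k; apply/andP; split.
  apply/injectiveP => i j.
  case: (unliftP ord0 i) => [i'|] ->; case: (unliftP ord0 j) => [j'|] ->;
    rewrite ?f0 ?fS //.
  - move=> wij; congr lift; apply: g_inj; apply: val_inj.
    by rewrite (wP i').2 (wP j').2 wij.
  - by move/eqP; rewrite (negPf (wP i').1).
  - by move/esym/eqP; rewrite (negPf (wP j').1).
apply/forall_inP => _ /imsetP[i _ ->]; apply/existsP; exists (g i).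
rewrite imsetU1 imset_set1 f0 fS -(wP i).2 eqxx /=.
by have := gB i; rewrite inE => /andP[].
Qed.

Lemma star_freeP (t r : nat) (T : finType) (G : sgraph T) (c : coloring r G) :
  reflect (forall v k, (#|[set e in edges_at G v | c e == k]| < t)%N)
    (~~ has_mono_copy (star t) c).
Proof.
rewrite has_mono_starE.
apply: (iffP existsPn) => [H v k|H v].
  by have /existsPn/(_ k) := H v; rewrite ltnNge.
by apply/existsPn => k; rewrite -ltnNge.
Qed.

(** * Counting colorings of stars and double stars *)

Lemma ffun_proj_eq (E X : finType) (S : {set E}) (c c' : {ffun E -> X}) :
  ffun_proj S c = ffun_proj S c' <->
  forall e, e \in S -> c e = c' e.
Proof.
split=> [/ffunP cc' e eS|cc']; first by have := cc' e; rewrite !ffunE eS => -[].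
by apply/ffunP => e; rewrite !ffunE; case: ifP => // eS; rewrite cc'.
Qed.

(** Restricting further to [S] and to [S'] is jointly injective on the projections to the union. *)
Lemma card_projU (E X : finType) (S S' : {set E}) (F : {set {ffun E -> X}}) :
  (#|ffun_proj (S :|: S') @: F|
     <= #|ffun_proj S @: F| * #|ffun_proj S' @: F|)%N.
Proof.
pose mask (U : {set E}) (p : {ffun E -> option X}) : {ffun E -> option X} :=
  [ffun e => if e \in U then p e else None].
have maskE (U : {set E}) (c : {ffun E -> X}) : U \subset S :|: S' ->
    mask U (ffun_proj (S :|: S') c) = ffun_proj U c.
  move=> sU; apply/ffunP => e; rewrite !ffunE.
  by case: ifP => // /(fintype.subsetP sU) ->.
rewrite -cardsX -(card_in_imset (f := fun p => (mask S p, mask S' p))).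
  apply/subset_leq_card/fintype.subsetP => _ /imsetP[_ /imsetP[c cF ->] ->].
  by rewrite inE /= !maskE ?finset.subsetUl ?finset.subsetUr ?imset_f.
move=> _ _ /imsetP[c cF ->] /imsetP[c' c'F ->] [].
rewrite !maskE ?finset.subsetUl ?finset.subsetUr //.
move=> /ffun_proj_eq cS /ffun_proj_eq cS'.
by apply/ffun_proj_eq => e; rewrite inE => /orP[/cS|/cS'].
Qed.

(** [rev_ord] serves as the exchange of the two colors. *)
Lemma neq_ord2 (a b : 'I_2) : (b != a) = (b == rev_ord a).
Proof. by case: a b => [[|[|?]] ?] [[|[|?]] ?]. Qed.

Lemma card_proj_fix (E : finType) (S : {set E}) (F : {set {ffun E -> 'I_2}})
    (e : E) (m : nat) :
  (forall a, #|ffun_proj S @: [set c in F | c e == a]| <= m)%N ->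
  (#|ffun_proj S @: F| <= 2 * m)%N.
Proof.
move=> Fm; pose Fa a := [set c : {ffun E -> 'I_2} in F | c e == a].
have -> : F = Fa ord0 :|: Fa (rev_ord ord0).
  by apply/setP=> c; rewrite !inE -neq_ord2 -andb_orr orbN andbT.
by rewrite imsetU (leq_trans (leq_card_setU _ _)) // mul2n -addnn leq_add ?Fm.
Qed.

(* Only meaningful for [0 < d]; the value 1 at [d = 0] is a harmless bound. *)
Definition star_extensions (d : nat) : nat :=
  ((d <= 3) + (d <= 4) * d.-1)%N.

(** [N] stands for the other edges at a vertex and [B] for those sharing the color of the fixed
    edge: at most one more has that color and at most two have the other. The empty [B] needs
    [#|N| <= 2], a singleton needs [#|N| <= 3]; these are the two terms of [star_extensions]. *)
Lemma card_small_subsets (T : finType) (N : {set T}) :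
  (#|[set B : {set T} | [&& B \subset N, (#|B| <= 1)%N & (#|N| <= #|B| + 2)%N]]|
     <= star_extensions #|N|.+1)%N.
Proof.
have sub : [set B : {set T} | [&& B \subset N, (#|B| <= 1)%N & (#|N| <= #|B| + 2)%N]]
    \subset (if (#|N| <= 2)%N then [set finset.set0] else finset.set0) :|:
            (if (#|N| <= 3)%N then [set B : {set T} | (B \subset N) && (#|B| == 1%N)]
             else finset.set0).
  apply/fintype.subsetP => B; rewrite !inE => /and3P[BN].
  case cB: #|B| => [|[|b]] // _ Nb.
    by rewrite Nb (cards0_eq cB) inE eqxx.
  by rewrite Nb inE BN cB orbT.
apply: leq_trans (subset_leq_card sub) _.
apply: leq_trans (leq_card_setU _ _) _; rewrite /star_extensions !ltnS leq_add //.
  by case: ifP => // _; rewrite ?cards1 ?cards0.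
by case: ifP => // _; rewrite ?cards0 // cards_draws bin1 mul1n.
Qed.

(** With two colors and [e] colored [a], a coloring of the star is determined by the set of other
    edges colored [a], which [h] extracts. *)
Lemma card_proj_star (T : finType) (G : sgraph T) (v : T) (e : edge G)
    (F : {set coloring 2 G}) (a : 'I_2) :
  (forall c, c \in F -> ~~ has_mono_copy (star 3) c) ->
  e \in edges_at G v ->
  (#|ffun_proj (edges_at G v) @: [set c in F | c e == a]|
     <= star_extensions #|edges_at G v|)%N.
Proof.
move=> Ffree ev; pose N := edges_at G v :\ e.
have cN : #|edges_at G v| = #|N|.+1 by rewrite (cardsD1 e) ev.
pose h (p : {ffun edge G -> option 'I_2}) := [set f in N | p f == Some a].
have hE (c : coloring 2 G) :
    h (ffun_proj (edges_at G v) c) = [set f in N | c f == a].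
  apply/setP => f; rewrite !inE ffunE inE.
  by case: (boolP (v \in val f)); rewrite ?andbF.
rewrite cN -(card_in_imset (f := h)).
  apply: leq_trans (card_small_subsets N).
  apply/subset_leq_card/fintype.subsetP => _ /imsetP[_ /imsetP[c + ->] ->].
  rewrite inE hE inE => /andP[/Ffree/star_freeP free /eqP ce].
  apply/and3P; split; first by apply/fintype.subsetP => f; rewrite inE => /andP[].
    have := free v a; rewrite (cardsD1 e) inE ev ce eqxx add1n !ltnS.
    apply: leq_trans; apply/subset_leq_card/fintype.subsetP => f.
    by rewrite !inE -andbA.
  have := free v (rev_ord a); rewrite ltnS => free'.
  rewrite -(cardsID [set f | c f == a] N) leq_add //.
    by apply/subset_leq_card/fintype.subsetP => f; rewrite !inE.
  apply: leq_trans free'; apply/subset_leq_card/fintype.subsetP => f.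
  by rewrite !inE neq_ord2 => /and3P[-> _ ->].
move=> _ _ /imsetP[c + ->] /imsetP[c' + ->]; rewrite !inE !hE.
move=> /andP[_ /eqP ce] /andP[_ /eqP c'e] /setP hcc'; apply/ffun_proj_eq => f fv.
have [->|fe] := eqVneq f e; first by rewrite ce c'e.
have vf : v \in val f by move: fv; rewrite inE.
have := hcc' f; rewrite !inE fe vf /=.
have [->|ca] := eqVneq (c f) a; first by move/esym/eqP.
have [//|c'a _] := eqVneq (c' f) a.
by move: ca c'a; rewrite !neq_ord2 => /eqP-> /eqP->.
Qed.

(** * Weights and the covering condition *)

Definition deg (T : finType) (G : sgraph T) (v : T) : nat := #|edges_at G v|.

Definition double_star (T : finType) (G : sgraph T) (e : edge G) :
    {set edge G} :=
  [set f | [exists v in val e, f \in edges_at G v]].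

Lemma double_starE (T : finType) (G : sgraph T) (e : edge G) (u w : T) :
  val e = [set u; w] -> double_star e = edges_at G u :|: edges_at G w.
Proof.
move=> ee; apply/setP => f; rewrite !inE ee; apply/existsP/orP => /=.
  by move=> [v]; rewrite !inE => /andP[/orP[] /eqP->] ->; [left|right].
by case=> fv; [exists u|exists w]; rewrite !inE fv eqxx ?orbT.
Qed.

Lemma double_star_sym (T : finType) (G : sgraph T) (e f : edge G) :
  (e \in double_star f) = (f \in double_star e).
Proof.
by rewrite !inE; apply/existsP/existsP => -[v /andP[H1 H2]];
  exists v; move: H1 H2; rewrite !inE => -> ->.
Qed.

Definition vertex_weight (d : nat) : nat :=
  if d == 3%N then 3 else if d == 4%N then 1 else 0.

Definition edge_weight (T : finType) (G : sgraph T) (e : edge G) : nat :=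
  (\sum_(v in val e) vertex_weight (deg G v))%N.

Definition incident_weight (T : finType) (G : sgraph T) (v : T) : nat :=
  (\sum_(e in edges_at G v) edge_weight e)%N.

(* When [deg G v <= 4], [incident_weight_le] below shows that the subtraction is
   not truncated. *)
Definition star_weight (T : finType) (G : sgraph T) (v : T) : nat :=
  (15 + vertex_weight (deg G v) - incident_weight G v)%N.

Lemma sum_pair (T : finType) (f : T -> nat) (u w : T) : u != w ->
  (\sum_(v in [set u; w]) f v = f u + f w)%N.
Proof. by move=> uw; rewrite big_setU1 ?inE //= big_set1. Qed.

(** Each edge at [v] weighs at most [vertex_weight (deg G v) + 3]. Summing leaves no slack: 3 * 6 =
    15 + 3 for degree 3 and 4 * 4 = 15 + 1 for degree 4. *)
Lemma incident_weight_le (T : finType) (G : sgraph T) (v : T) :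
  (deg G v <= 4)%N -> (incident_weight G v <= 15 + vertex_weight (deg G v))%N.
Proof.
move=> deg4.
have zle d : (vertex_weight d <= 3)%N by rewrite /vertex_weight; do 2?case: ifP.
apply: (@leq_trans (deg G v * (vertex_weight (deg G v) + 3))).
  rewrite -sum_nat_const leq_sum // => e /edge_at_pair[w wv].
  by rewrite /edge_weight => ->; rewrite sum_pair 1?eq_sym // leq_add2l.
by move: deg4; case: (deg G v) => [|[|[|[|[|]]]]].
Qed.

(** The double stars containing [e] are those of the edges at either endpoint, with [e] itself
    occurring at both. So their weights sum to s(u) + s(w) - z(u) - z(w), which the two star weights
    complete to 30. *)
Lemma edge_cover (T : finType) (G : sgraph T) (e : edge G) :
  (forall v, deg G v <= 4)%N ->
  (30 <= \sum_(v | e \in edges_at G v) star_weight G v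
         + \sum_(f | e \in double_star f) edge_weight f)%N.
Proof.
move=> deg4.
have [u [w [uw ee]]] := edge_pair e.
have -> : (\sum_(v | e \in edges_at G v) star_weight G v
    = star_weight G u + star_weight G w)%N.
  by rewrite -sum_pair // -ee; apply: eq_bigl => v; rewrite inE.
(* The graph is simple, so only [e] is incident with both endpoints. *)
have inter f : f \in edges_at G u -> f \in edges_at G w -> f = e.
  rewrite !inE => fu fw; apply/val_inj/esym/eqP; rewrite eqEcard !card_edge andbT.
  by rewrite ee; apply/fintype.subsetP => x; rewrite !inE => /orP[] /eqP->.
have : (incident_weight G u + incident_weight G w <=
    \sum_(f | e \in double_star f) edge_weight f + edge_weight e)%N.
  rewrite /incident_weight.
  rewrite [X in (X + _ <= _)%N]big_mkcond [X in (_ + X <= _)%N]big_mkcond /=.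
  rewrite -big_split /= [X in (_ <= X + _)%N]big_mkcond.
  have -> : edge_weight e = (\sum_f if f == e then edge_weight f else 0)%N.
    by rewrite -big_mkcond big_pred1_eq.
  rewrite -big_split leq_sum //= => f _.
  rewrite double_star_sym (double_starE ee) finset.in_setU.
  case: (boolP (f \in edges_at G u)) => fu; case: (boolP (f \in _)) => fw //=.
    by rewrite (inter _ fu fw) eqxx.
  by rewrite addn0 leq_addr.
  by rewrite leq_addr.
have := subnK (incident_weight_le (deg4 u)).
have := subnK (incident_weight_le (deg4 w)).
have : edge_weight e = (vertex_weight (deg G u) + vertex_weight (deg G w))%N.
  by rewrite /edge_weight ee sum_pair.
by rewrite /star_weight; lia.
Qed.

(** Double counting of incidences; it spreads the powers of 2 saved by the double stars over the
    vertices. *)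
Lemma sum_incident (T : finType) (G : sgraph T) :
  (\sum_(e : edge G) edge_weight e
     = \sum_v vertex_weight (deg G v) * deg G v)%N.
Proof.
rewrite (exchange_big_dep predT) //=; apply: eq_bigr => v _.
rewrite sum_nat_const mulnC; congr (_ * _)%N.
by apply: eq_card => e; rewrite !inE.
Qed.

(** The same exchange spreads the double star bounds over the vertices. *)
Lemma prod_edge_endpoints (R : realType) (T : finType) (G : sgraph T)
    (x : T -> R) :
  \prod_(e : edge G) (\prod_(v in val e) x v) ^+ edge_weight e
    = \prod_v x v ^+ incident_weight G v.
Proof.
transitivity (\prod_(e : edge G) \prod_(v in val e) x v ^+ edge_weight e).
  by apply: eq_bigr => e _; rewrite prodrXl.
rewrite (exchange_big_dep predT) //=; apply: eq_bigr => v _.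
by rewrite -prodrXr; apply: eq_bigl => e; rewrite !inE.
Qed.

(** * The bound for a single graph *)

Lemma deg_star_free (T : finType) (G : sgraph T) (c : coloring 2 G) v :
  ~~ has_mono_copy (star 3) c -> (deg G v <= 4)%N.
Proof.
move=> /star_freeP free.
rewrite /deg -(cardsID [set f | c f == ord0] (edges_at G v)).
rewrite -[4%N]/(2 + 2)%N leq_add //.
  apply: leq_trans (free v ord0 : _ <= 2)%N.
  by apply/subset_leq_card/fintype.subsetP => f; rewrite !inE.
apply: leq_trans (free v (rev_ord ord0) : _ <= 2)%N.
by apply/subset_leq_card/fintype.subsetP => f; rewrite !inE neq_ord2 andbC.
Qed.

(** For [d <= 2] the base is at most 4, and 4^15 <= 18^9 reduces to 2^7 <= 3^6. For [d = 3] there is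
    equality, as 6^18 = 36^9. For [d = 4], cancelling 6^13 leaves 6^3 <= 3^5. *)
Lemma star_extensions_bound (R : realType) (d : nat) : (d <= 4)%N ->
  (2 * star_extensions d)%:R ^+ (15 + vertex_weight d)
     <= 18 ^+ 9 * 2 ^+ (vertex_weight d * d) :> R.
Proof.
have E18 : 18 = 2 * 3 ^+ 2 :> R by ring.
have E6 : 6 = 2 * 3 :> R by ring.
have le4 (x : R) : 0 <= x <= 4 -> x ^+ 15 <= 18 ^+ 9.
  move=> /andP[x0 x4]; apply: (@le_trans _ _ (4 ^+ 15)).
    by rewrite lerXn2r ?nnegrE ?ler0n.
  have -> : (4 : R) ^+ 15 = 2 ^+ 9 * (2 ^+ 7) ^+ 3.
    by rewrite -exprM -exprD (_ : 4 = 2 ^+ 2) -?exprM //; ring.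
  have -> : (18 : R) ^+ 9 = 2 ^+ 9 * (3 ^+ 6) ^+ 3.
    by rewrite -exprM E18 exprMn -exprM.
  rewrite ler_wpM2l ?exprn_ge0 ?ler0n // lerXn2r ?nnegrE ?exprn_ge0 ?ler0n //.
  by lra.
case: d => [|[|[|[|[|d]]]]] // _.
- by rewrite muln0 expr0 mulr1; apply: le4; rewrite ler0n ler_nat.
- by rewrite mul0n expr0 mulr1; apply: le4; rewrite ler0n ler_nat.
- by rewrite mul0n expr0 mulr1; apply: le4; rewrite ler0n ler_nat.
- rewrite -[(2 * _)%N]/6%N -[(15 + _)%N]/(2 * 9)%N -[(_ * 3)%N]/9%N.
  by rewrite exprM -exprMn (_ : 6 ^+ 2 = 18 * 2) //; ring.
rewrite -[(2 * _)%N]/6%N -[(15 + _)%N]/(13 + 3)%N -[(_ * 4)%N]/4%N.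
have -> : (18 : R) ^+ 9 * 2 ^+ 4 = 6 ^+ 13 * (3 ^+ 5).
  rewrite E6 E18 [in LHS]exprMn [in RHS]exprMn -exprM mulrAC -exprD.
  by rewrite -[RHS]mulrA -[in RHS]exprD.
by rewrite exprD ler_wpM2l ?exprn_ge0 ?ler0n //; lra.
Qed.

Lemma card_proj_vertex (T : finType) (G : sgraph T) (F : {set coloring 2 G})
    (v : T) :
  (forall c, c \in F -> ~~ has_mono_copy (star 3) c) ->
  (#|ffun_proj (edges_at G v) @: F| <= 2 * star_extensions (deg G v))%N.
Proof.
move=> free; have [v0|[e ev]] := set_0Vmem (edges_at G v).
  have -> : (2 * star_extensions (deg G v) = 2)%N by rewrite /deg v0 cards0.
  apply: (@leq_trans #|[set [ffun=> None : option 'I_2] : {ffun edge G -> _}]|).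
    apply/subset_leq_card/fintype.subsetP => _ /imsetP[c _ ->].
    by rewrite inE; apply/eqP/ffunP => e; rewrite !ffunE v0 inE.
  by rewrite cards1.
by apply: (card_proj_fix (e := e)) => a; exact: card_proj_star.
Qed.

(** Once the color of [e], common to both stars, is fixed, the bounds for the two stars multiply.
    The factor 2 on the left avoids a division. *)
Lemma card_proj_double_star (T : finType) (G : sgraph T)
    (F : {set coloring 2 G}) (e : edge G) :
  (forall c, c \in F -> ~~ has_mono_copy (star 3) c) ->
  (2 * #|ffun_proj (double_star e) @: F|
     <= \prod_(v in val e) (2 * star_extensions (deg G v)))%N.
Proof.
move=> free; have [u [w [uw ee]]] := edge_pair e.
have eu : e \in edges_at G u by rewrite inE ee !inE eqxx.
have ew : e \in edges_at G w by rewrite inE ee !inE eqxx orbT.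
rewrite ee big_setU1 ?inE //= big_set1 -mulnA leq_mul2l /= mulnCA.
apply: (card_proj_fix (e := e)) => a; rewrite (double_starE ee).
by rewrite (leq_trans (card_projU _ _ _)) // leq_mul ?card_proj_star.
Qed.

Lemma num_colorings_star3_le (R : realType) (T : finType) (G : sgraph T) :
  (num_colorings 2 (star 3) G)%:R ^+ 30 <= (18 ^+ 9) ^+ #|T| :> R.
Proof.
rewrite /num_colorings; set F := [set c | _].
have free c : c \in F -> ~~ has_mono_copy (star 3) c by rewrite inE.
(* The degree bound needs an actual coloring, so the empty case is separate. *)
have [->|[c0 c0F]] := set_0Vmem F; first by rewrite cards0 expr0n /= !exprn_ge0.
have deg4 v : (deg G v <= 4)%N by exact: deg_star_free (free _ c0F).
pose wt (j : T + edge G) :=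
  match j with inl v => star_weight G v | inr e => edge_weight e end.
pose S (j : T + edge G) :=
  match j with inl v => edges_at G v | inr e => double_star e end.
pose A v : R := (2 * star_extensions (deg G v))%N%:R.
have := @shearer R _ _ _ 30 wt S F isT.
have cover e : (30 <= \sum_(j | e \in S j) wt j)%N.
  by rewrite big_sumType /= edge_cover.
move=> /(_ cover); rewrite big_sumType /= => Fle.
(* [W] collects the factors 2 on the left of [card_proj_double_star]; it is cancelled at the end. *)
pose W := \prod_(e : edge G) (2 : R) ^+ edge_weight e.
have W_gt0 : 0 < W by apply: prodr_gt0 => e _; rewrite exprn_gt0.
have WE : W = \prod_v 2 ^+ (vertex_weight (deg G v) * deg G v).
  by rewrite /W !prodrXr sum_incident.
have FW : #|F|%:R ^+ 30 * W <= \prod_v A v ^+ (15 + vertex_weight (deg G v)).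
  apply: (@le_trans _ _ ((\prod_v A v ^+ star_weight G v) *
      \prod_(e : edge G) (\prod_(v in val e) A v) ^+ edge_weight e)).
    apply: le_trans (ler_wpM2r (ltW W_gt0) Fle) _.
    rewrite -mulrA -big_split /=; apply: ler_pM.
    - by apply: prodr_ge0.
    - by apply: prodr_ge0 => e _; rewrite mulr_ge0.
    - apply: ler_prod => v _; rewrite exprn_ge0 //= lerXn2r ?nnegrE // ler_nat.
      exact: card_proj_vertex.
    apply: ler_prod => e _; rewrite -exprMn exprn_ge0 ?mulr_ge0 //=.
    have -> : \prod_(v in val e) A v
        = (\prod_(v in val e) (2 * star_extensions (deg G v)))%N%:R.
      by rewrite natr_prod.
    rewrite lerXn2r ?nnegrE ?mulr_ge0 //.
    by rewrite mulrC -natrM ler_nat card_proj_double_star.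
  rewrite prod_edge_endpoints -big_split /= le_eqVlt; apply/orP; left.
  apply/eqP; apply: eq_bigr => v _.
  by rewrite -exprD subnK // incident_weight_le.
rewrite -(ler_pM2r W_gt0); apply: le_trans FW _.
have -> : (18 ^+ 9) ^+ #|T| = \prod_(v : T) (18 ^+ 9 : R) by rewrite prodr_const.
rewrite WE -big_split /=; apply: ler_prod => v _; rewrite exprn_ge0 //=.
exact: star_extensions_bound.
Qed.

(** * Disjoint unions and supermultiplicativity *)

Definition disjoint_union_edges (m n : nat) (G1 : sgraph 'I_m)
    (G2 : sgraph 'I_n) : {set {set 'I_(m + n)}} :=
  [set @lshift m n @: e | e : {set _} in edges G1]
    :|: [set @rshift m n @: e | e : {set _} in edges G2].

Lemma disjoint_union_edgesP (m n : nat) (G1 : sgraph 'I_m) (G2 : sgraph 'I_n) :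
  [forall e in disjoint_union_edges G1 G2, #|e| == 2%N].
Proof.
apply/forall_inP => e; rewrite inE => /orP[] /imsetP[e' e'G ->].
  by rewrite card_imset ?(card_edge (exist _ e' e'G)) //; exact: lshift_inj.
by rewrite card_imset ?(card_edge (exist _ e' e'G)) //; exact: rshift_inj.
Qed.

Definition disjoint_union (m n : nat) (G1 : sgraph 'I_m) (G2 : sgraph 'I_n) :
  sgraph 'I_(m + n) := SGraph (disjoint_union_edgesP G1 G2).

(** Every pair of star-free colorings is the image under [split_coloring] of a star-free one: gluing
    creates no monochromatic star, since all edges at a vertex come from one summand. *)
Lemma num_colorings_disjoint_union (t r m n : nat) (G1 : sgraph 'I_m)
    (G2 : sgraph 'I_n) :
  (num_colorings r (star t) G1 * num_colorings r (star t) G2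
     <= num_colorings r (star t) (disjoint_union G1 G2))%N.
Proof.
set G := disjoint_union G1 G2.
have in1 (e : edge G1) : @lshift m n @: val e \in edges G.
  by rewrite inE imset_f ?(valP e).
have in2 (e : edge G2) : @rshift m n @: val e \in edges G.
  by rewrite inE orbC imset_f ?(valP e).
pose i1 e : edge G := exist (fun s => is_true (s \in edges G)) _ (in1 e).
pose i2 e : edge G := exist (fun s => is_true (s \in edges G)) _ (in2 e).
have i1_inj : injective i1.
  by move=> e f /(congr1 val) /= /(imset_inj (@lshift_inj m n)) /val_inj.
have i2_inj : injective i2.
  by move=> e f /(congr1 val) /= /(imset_inj (@rshift_inj m n)) /val_inj.
have i12 e f : i1 e <> i2 f.
  move=> /(congr1 val) /= ef; have [u [w [_ ee]]] := edge_pair e.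
  have : lshift n u \in @lshift m n @: val e by rewrite imset_f // ee !inE eqxx.
  by rewrite ef => /imsetP[x _ /eqP]; rewrite eq_lrshift.
have onto (e : edge G) : (exists e1, e = i1 e1) \/ (exists e2, e = i2 e2).
  have := valP e; rewrite inE => /orP[] /imsetP[e' e'G ee].
    by left; exists (exist _ e' e'G); apply: val_inj.
  by right; exists (exist _ e' e'G); apply: val_inj.
pose split_coloring (c : coloring r G) : coloring r G1 * coloring r G2 :=
  ([ffun e => c (i1 e)], [ffun e => c (i2 e)]).
rewrite /num_colorings -cardsX.
apply: leq_trans (leq_imset_card split_coloring _).
apply/subset_leq_card/fintype.subsetP => -[c1 c2]; rewrite !inE /=.
move=> /andP[/star_freeP free1 /star_freeP free2].
have /fin_all_exists[c cP] (e : edge G) : exists k : 'I_r,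
    (forall e1, e = i1 e1 -> k = c1 e1) /\ (forall e2, e = i2 e2 -> k = c2 e2).
  case: (onto e) => -[e' ->].
    by exists (c1 e'); split=> [f /i1_inj ->//|f /i12].
  by exists (c2 e'); split=> [f /esym/i12|f /i2_inj ->].
have cc1 e : c (i1 e) = c1 e by apply: (cP _).1.
have cc2 e : c (i2 e) = c2 e by apply: (cP _).2.
apply/imsetP; exists [ffun e => c e]; last first.
  by congr pair; apply/ffunP => e; rewrite !ffunE.
rewrite inE; apply/star_freeP => v k.
case: (split_ordP v) => x ->.
  apply: leq_ltn_trans (free1 x k); rewrite -(card_imset _ i1_inj).
  apply/subset_leq_card/fintype.subsetP => e; rewrite !inE ffunE => /andP[xe ce].
  case: (onto e) => -[e' ee]; move: xe ce; rewrite ee /=.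
    rewrite mem_imset ?cc1 => [xe ce|]; last exact: lshift_inj.
    by rewrite imset_f // !inE xe ce.
  by move=> /imsetP[y _ /eqP]; rewrite eq_lrshift.
apply: leq_ltn_trans (free2 x k); rewrite -(card_imset _ i2_inj).
apply/subset_leq_card/fintype.subsetP => e; rewrite !inE ffunE => /andP[xe ce].
case: (onto e) => -[e' ee]; move: xe ce; rewrite ee /=.
  by move=> /imsetP[y _ /eqP]; rewrite eq_rlshift.
rewrite mem_imset ?cc2 => [xe ce|]; last exact: rshift_inj.
by rewrite imset_f // !inE xe ce.
Qed.

Lemma empty_graphP (T : finType) :
  [forall e in (finset.set0 : {set {set T}}), #|e| == 2%N].
Proof. by apply/forall_inP => e; rewrite inE. Qed.

Lemma max_num_colorings_attained (r n : nat) (S : finType) (H : sgraph S) :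
  exists G : sgraph 'I_n, max_num_colorings r H n = num_colorings r H G.
Proof.
have [|G GE] := @bigop.eq_bigmax (sgraph 'I_n) (fun G => num_colorings r H G).
  by apply/card_gt0P; exists (SGraph (empty_graphP 'I_n)).
by exists G.
Qed.

Lemma max_num_colorings_star_supermul (t r m n : nat) :
  (max_num_colorings r (star t) m * max_num_colorings r (star t) n
     <= max_num_colorings r (star t) (m + n))%N.
Proof.
have [G1 ->] := max_num_colorings_attained r m (star t).
have [G2 ->] := max_num_colorings_attained r n (star t).
apply: leq_trans (num_colorings_disjoint_union _ _ _ _) _.
exact: (leq_bigmax (disjoint_union G1 G2)).
Qed.

(** The edgeless graph has the empty coloring, even for [r = 0]. *)
Lemma max_num_colorings_star_gt0 (t r n : nat) :
  (0 < t)%N -> (0 < max_num_colorings r (star t) n)%N.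
Proof.
move=> t_gt0; pose G := SGraph (empty_graphP 'I_n).
apply: leq_trans (leq_bigmax G); apply/card_gt0P.
have noedge (e : edge G) : False by have := valP e; rewrite inE.
exists [ffun e => False_rect _ (noedge e)]; rewrite inE; apply/star_freeP => v k.
by rewrite eq_card0 // => e; case: (noedge e).
Qed.

(** * The bound over all graphs and the limit *)

Lemma max_num_colorings_star3_le (R : realType) (n : nat) :
  (max_num_colorings 2 (star 3) n)%:R <= (18 `^ (3 / 10)) ^+ n :> R.
Proof.
have [G ->] := max_num_colorings_attained 2 n (star 3).
(* The 30th power turns 18^(3/10) into the 18^9 of the bound for a single graph. *)
rewrite -(@ler_pXn2r _ 30) ?nnegrE ?exprn_ge0 ?powR_ge0 ?ler0n //.
rewrite exprAC -[X in _ <= X ^+ n]powR_mulrn ?powR_ge0 // -powRrM.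
have -> : 3 / 10 * 30 = 9%:R :> R by lra.
rewrite powR_mulrn ?ler0n // -[n in leRHS]card_ord.
exact: num_colorings_star3_le.
Qed.

Theorem theorem4 (R : realType) :
  (exists c : R, forall n : nat, (0 < n)%N ->
     (max_num_colorings 2 (star 3) n)%:R <= c * 18 `^ (3 * n%:R / 10)) /\
  cvgn (root_max_num_colorings R 2 (star 3)) /\
  (coloring_growth R 2 (star 3) <= (18 `^ (3 / 10))%:E)%E.
Proof.
have B_gt0 : 0 < 18 `^ (3 / 10) :> R by rewrite powR_gt0.
have cvg_root : cvgn (root_max_num_colorings R 2 (star 3)).
  have /cvg_ex[/= l ul] := @supermultiplicative_root_cvg R _ _ B_gt0
    (fun n => max_num_colorings_star_gt0 2 n (isT : 0 < 3)%N)
    (fun m n => max_num_colorings_star_supermul 3 2 m n)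
    (max_num_colorings_star3_le R).
  by apply/cvg_ex; exists l%:E; apply: cvg_EFin ul; apply: nearW.
split; [|split=> //].
  exists 1 => n _; rewrite mul1r.
  have -> : 3 * n%:R / 10 = 3 / 10 * n%:R :> R by lra.
  by rewrite powRrM powR_mulrn ?powR_ge0 ?max_num_colorings_star3_le.
apply: lime_le => //; near=> n; rewrite lee_fin.
(* At [n = 0] the exponent [n%:R^-1] is 0, so the next identity needs [n] positive. *)
have n_gt0 : (0 < n)%N by near: n; exact: nbhs_infty_gt.
have -> : 18 `^ (3 / 10) = ((18 `^ (3 / 10)) ^+ n) `^ n%:R^-1 :> R.
  rewrite -powR_mulrn ?powR_ge0 // -powRrM mulfV ?powRr1 ?powR_ge0 //.
  by rewrite pnatr_eq0 -lt0n.
by rewrite ge0_ler_powR ?nnegrE ?exprn_ge0 ?powR_ge0 ?max_num_colorings_star3_le.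
Unshelve. all: by end_near. Qed.
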